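(* Let $s,t\geq 1$ be integers and let $p,q,l$ be three distinct primes with $p,q$ odd, $p\equiv 3 \pmod 4$, $\mathrm{ord}_{p^s}(l)=\phi(p^s)/2$, $\mathrm{ord}_{q^t}(l)=\phi(q^t)$ and $\gcd(\phi(p^s),\phi(q^t))=2$. Let $0\leq i<i'\leq s-1$ and $0\leq j\leq t-1$. Then in the ring $\mathbb{F}_l[x]/\langle x^{p^sq^t}-1\rangle$: (i) If $q$ is a quadratic residue modulo $p$, then \[\chi_{ij}\chi_{i'j}=\frac{\phi(p^{s-i'})}{2}(q-2)q^{t-j-1}\chi_{ij}+\frac{\phi(p^{s-i'})}{2}\phi(q^{t-j})\sum_{j<m\leq t}\chi_{im}.\] (ii) If $q$ is a quadratic nonresidue modulo $p$, then \[ \chi_{ij}\chi_{i'j}=\frac{\phi(p^{s-i'})}{2}(q-2)q^{t-j-1}\chi_{ij}+\frac{\phi(p^{s-i'})}{2}\phi(q^{t-j})\Big(\sum_{\substack{j<m\leq t\\2\nmid m-j}}\chi_{im}^*+\sum_{\substack{j<m\leq t\\2\mid m-j}}\chi_{im}\Big). \]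
   Context: Here $\phi$ is Euler's phi function (with $\phi(1)=1$) and $\mathrm{ord}_m(k)$ is the multiplicative order of $k$ modulo $m$. Put $n=p^sq^t$. Fix an integer $g$ that is a primitive root both modulo $p^s$ and modulo $q^t$. For an integer $\gamma$, $C_\gamma=\{\gamma l^r \bmod n: r\geq 0\}\subseteq \mathbb{Z}_n$ is the $l$-cyclotomic coset modulo $n$ containing $\gamma$. For $0\leq i\leq s$, $0\leq j\leq t$ set $C_{ij}=C_{p^iq^j}$ and $C_{ij}^*=C_{p^iq^jg}$. Define elements of $\mathbb{F}_l[x]/\langle x^{n}-1\rangle$ by $\chi_{ij}=\sum_{\alpha\in C_{ij}}x^\alpha$ and $\chi_{ij}^*=\sum_{\alpha\in C_{ij}^*}x^\alpha$. Integer coefficients are read in $\mathbb{F}_l$, and empty sums are $0$. *)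

(* Defs.v *)
From mathcomp Require Import all_boot all_order all_fingroup all_algebra.
From mathcomp Require Export qpoly.

Set Implicit Arguments.
Unset Strict Implicit.
Unset Printing Implicit Defensive.

Import GRing.Theory.
Local Open Scope ring_scope.

(* Junk value 0 when k is not invertible modulo m.  Since 'Z_m is the ring of
   integers modulo max(m, 2), this is meaningful only for m > 1. *)
Definition mulord (m : nat) (k : int) : nat :=
  if insub (k%:~R : 'Z_m) is Some u then #[u : {unit 'Z_m}]%g else 0%N.

Definition primitive_root_mod (m : nat) (g : int) : bool :=
  mulord m g == totient m.

Definition quadratic_residue (p a : nat) : bool :=
  coprime p a && [exists x : 'I_p, x ^ 2 == a %[mod p]]%N.

Definition quadratic_nonresidue (p a : nat) : bool :=
  coprime p a && ~~ [exists x : 'I_p, x ^ 2 == a %[mod p]]%N.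

(* The orbit of gamma under multiplication by l; see mem_cyclotomic_coset. *)
Definition cyclotomic_coset (l n : nat) (gamma : int) : {set 'Z_n} :=
  [set a | fconnect (fun x : 'Z_n => x * l%:R) gamma%:~R a].

Lemma mem_cyclotomic_coset (l n : nat) (gamma : int) (a : 'Z_n) :
  (a \in cyclotomic_coset l n gamma) <->
  (exists r : nat, a = (gamma * (l ^ r)%:Z)%:~R).
Proof.
have iterE r : iter r (fun x : 'Z_n => x * l%:R) gamma%:~R
               = (gamma * (l ^ r)%:Z)%:~R.
  rewrite intrM -pmulrn natrX; elim: r => [|r IHr] /=; first by rewrite mulr1.
  by rewrite IHr exprSr mulrA.
rewrite inE; split=> [/iter_findex <-|[r ->]].
  by eexists; apply: iterE.
by rewrite -iterE; apply: fconnect_iter.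
Qed.

(* {poly %/ h} is the quotient by <h> only if h is monic of size at least 2;
   see mk_monic_Xn_sub_1. *)
Notation cyclic_ring l n := {poly %/ ('X^n - 1 : {poly 'F_l})}.

Lemma mk_monic_Xn_sub_1 (l n : nat) :
  (0 < n)%N -> mk_monic ('X^n - 1 : {poly 'F_l}) = 'X^n - 1.
Proof.
by move=> n_gt0; rewrite /mk_monic size_XnsubC // ltnS n_gt0 monicXnsubC.
Qed.

Definition coset_sum (l n : nat) (gamma : int) : cyclic_ring l n :=
  \sum_(a in cyclotomic_coset l n gamma) 'qX ^+ a.

Definition chi (p q s t l i j : nat) : cyclic_ring l (p ^ s * q ^ t) :=
  coset_sum l (p ^ s * q ^ t) (p ^ i * q ^ j)%:Z.

Definition chi_star (p q s t l : nat) (g : int) (i j : nat) :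
    cyclic_ring l (p ^ s * q ^ t) :=
  coset_sum l (p ^ s * q ^ t) ((p ^ i * q ^ j)%:Z * g).

(* Main.v *)
(* Since l generates the squares modulo p ^ s and all units modulo q ^ t, and
   the two orders are coprime, the Chinese remainder theorem describes C_ij
   (for i < s) as the c such that c lies in p ^ i * q ^ j * <l> modulo p ^ s
   and gcd(c, q ^ t) = q ^ j.  The coefficient of x ^ c in the product counts
   the b in C_i'j with c - b in C_ij.  As i < i', translation by b preserves the
   condition modulo p ^ s.  Among the c that satisfy it (the others count 0),
   the count is #|C_i'j| if q ^ j.+1 divides c, and #|C_i'j| minus the number
   #|C_i'j| / (q - 1) of b congruent to c modulo q ^ j.+1 if c lies in C_ij.
   The c of the former kind with
   gcd(c, q ^ t) = q ^ m form the coset of p ^ i * q ^ m if q ^ (m - j) is a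
   square modulo p, and that of p ^ i * q ^ m * g otherwise. *)
Require Import Defs.
From mathcomp Require Import all_boot all_order all_fingroup all_algebra.
From mathcomp Require Import all_solvable.
Set Implicit Arguments.
Unset Strict Implicit.
Unset Printing Implicit Defensive.
Import GRing.Theory FinRing.Theory.
Local Open Scope ring_scope.

(** * Multiplicative orders and powers of l *)

Lemma eqZp_modn (m a b : nat) : (1 < m)%N ->
  ((a%:R : 'Z_m) == b%:R) = (a == b %[mod m])%N.
Proof. by move=> m_gt1; rewrite -val_eqE /= !val_Zp_nat. Qed.

(** Positivity of [mulord] excludes its default value 0, so k is a unit and [mulord] is its true
    order. *)
Lemma mulordP (m k : nat) : (1 < m)%N -> (0 < mulord m k%:Z)%N ->
  coprime m k /\ forall r, (k ^ r == 1 %[mod m])%N = (mulord m k%:Z %| r)%N.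
Proof.
move=> m_gt1; rewrite /mulord -pmulrn; case: insubP => // u uU def_u _.
split=> [|r]; first by rewrite -unitZpE.
rewrite -eqZp_modn // natrX -def_u -val_unitX /= order_dvdn.
by rewrite -(inj_eq val_inj).
Qed.

(** A primitive root makes the unit group cyclic, and inclusion of subgroups of a cyclic group is
    divisibility of their orders: u is a power of l as soon as its order divides that of l. *)
Lemma mem_powers_of_exp_mulord (m l u : nat) (g : int) :
  (1 < m)%N -> primitive_root_mod m g -> coprime m l -> coprime m u ->
  (u ^ mulord m l%:Z = 1 %[mod m])%N -> exists r, (u = l ^ r %[mod m])%N.
Proof.
move=> m_gt1; rewrite /primitive_root_mod /mulord => g_prim.
rewrite -unitZpE // => lU; rewrite -unitZpE // => uU; rewrite -pmulrn insubT /=.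
move: g_prim; case: insubP => [v vU def_v|_]; last first.
  (* Were g not invertible, [mulord m g] would be the default 0, whereas the totient is positive. *)
  by rewrite eq_sym eqn0Ngt totient_gt0 (ltnW m_gt1).
move/eqP=> ord_v.
set x := Sub l%:R lU; set y : {unit 'Z_m} := Sub u%:R uU.
have cycU : cyclic [set: {unit 'Z_m}].
  apply/cyclicP; exists v; apply/eqP; rewrite eq_sym eqEcard subsetT /=.
  by rewrite -orderE ord_v -(card_units_Zp (ltnW m_gt1)) leqnn.
move=> yx1.
have {yx1} : (<[y]> \subset <[x]>)%g.
  rewrite -(cardSg_cyclic cycU) ?subsetT // -!orderE order_dvdn.
  rewrite -(inj_eq val_inj) val_unitX /= -natrX.
  by rewrite (eqZp_modn _ 1) //; apply/eqP.
rewrite cycle_subG => /cycleP[r def_y]; exists r.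
apply/eqP; rewrite -eqZp_modn // natrX; apply/eqP.
by move/(congr1 val): def_y; rewrite val_unitX.
Qed.

(** * Lifting congruences along powers of a prime *)

(** In y^p - 1 = (y - 1)(1 + y + ... + y^(p-1)) the last factor is a sum of p terms congruent to 1
    modulo p, which yields one more factor p. *)
Lemma pow_p_eq1_modn (p k y : nat) : prime p -> (0 < k)%N ->
  (y = 1 %[mod p ^ k])%N -> (y ^ p = 1 %[mod p ^ k.+1])%N.
Proof.
move=> p_pr k_gt0 y1; have p_gt0 := prime_gt0 p_pr.
have pk_gt1: (1 < p ^ k)%N by rewrite -(exp1n k) ltn_exp2r // prime_gt1.
have y_gt0 : (0 < y)%N.
  by case: y y1 => // /esym; rewrite mod0n modn_small.
have dvd_y1 : (p ^ k %| y.-1)%N by rewrite -subn1 -eqn_mod_dvd //; apply/eqP.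
apply/eqP; rewrite eqn_mod_dvd ?expn_gt0 ?y_gt0 // subn1 predn_exp expnSr.
apply: dvdn_mul => //.
have y1p : (y = 1 %[mod p])%N.
  by apply/eqP; rewrite eqn_mod_dvd // subn1 (dvdn_trans _ dvd_y1) // dvdn_exp.
rewrite /dvdn -modn_summ (eq_bigr (fun=> 1 %% p)%N); last first.
  by move=> i _; rewrite -modnXm y1p modnXm exp1n.
by rewrite modn_summ sum1_card card_ord modnn.
Qed.

Lemma pow_pX_eq1_modn (p k e y : nat) : prime p -> (0 < k)%N ->
  (y = 1 %[mod p ^ k])%N -> (y ^ (p ^ e) = 1 %[mod p ^ (k + e)])%N.
Proof.
move=> p_pr k_gt0 y1; elim: e => [|e IHe]; first by rewrite addn0.
by rewrite expnSr expnM addnS; apply: pow_p_eq1_modn; rewrite ?addn_gt0 ?k_gt0.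
Qed.

(** Raising l^d = 1 modulo p^k to the power p^(s-k) gives a congruence modulo p^s; hence p^(s-1) a
    divides p^(s-k) d, and p^(s-k) cancels. *)
Lemma dvdn_order_reduction (p s k a l d : nat) : prime p -> (0 < k <= s)%N ->
  (forall r, (l ^ r == 1 %[mod p ^ s])%N = (p ^ s.-1 * a %| r)%N) ->
  (l ^ d = 1 %[mod p ^ k])%N -> (p ^ k.-1 * a %| d)%N.
Proof.
move=> p_pr /andP[k_gt0 le_ks] ord_l ld1.
have := pow_pX_eq1_modn (s - k) p_pr k_gt0 ld1.
rewrite subnKC // -expnM => /eqP; rewrite ord_l.
have -> : (s.-1 = k.-1 + (s - k))%N by rewrite -{1}(subnKC le_ks) -!subn1 addnBAC.
by rewrite expnD mulnAC dvdn_pmul2r // expn_gt0 prime_gt0.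
Qed.

(** * Orbits under multiplication by l, one prime at a time *)

(** The exponents r1 and r2 matter only modulo hP and hQ; as these are coprime, the Chinese
    remainder theorem applied to exponents supplies one r for both moduli. *)
Lemma modn_chinese_powers (P Q hP hQ l c y : nat) :
  coprime P Q -> coprime hP hQ ->
  (l ^ hP = 1 %[mod P])%N -> (l ^ hQ = 1 %[mod Q])%N ->
  (exists r, c = y * l ^ r %[mod P])%N -> (exists r, c = y * l ^ r %[mod Q])%N ->
  (exists r, c = y * l ^ r %[mod P * Q])%N.
Proof.
move=> coPQ coh lP lQ [r1 c1] [r2 c2].
have pow_mod m h r r' : (l ^ h = 1 %[mod m])%N -> (r = r' %[mod h])%N ->
    (l ^ r = l ^ r' %[mod m])%N.
  move=> lh1 rr'; rewrite (divn_eq r h) (divn_eq r' h) !expnD !(mulnC _ h) !expnM.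
  by rewrite rr' -modnMml -modnXm lh1 modnXm exp1n modnMml mul1n
    -[in RHS]modnMml -[in RHS]modnXm lh1 modnXm exp1n modnMml mul1n.
exists (chinese hP hQ r1 r2); apply/eqP; rewrite chinese_remainder //.
by apply/andP; split; apply/eqP; rewrite ?c1 ?c2 -modnMmr -[in RHS]modnMmr;
  congr (_ %% _)%N; congr (_ * _)%N; apply: pow_mod; eauto;
  rewrite ?chinese_modl ?chinese_modr.
Qed.

(** When the powers of l exhaust the units modulo q^t, the orbits of multiplication by l are the
    classes of fixed gcd with q^t. *)
Lemma gcdn_eq_powers (q t l c y : nat) : prime q -> coprime q l ->
  (forall u, coprime q u -> exists r, u = l ^ r %[mod q ^ t])%N ->
  gcdn c (q ^ t) = gcdn y (q ^ t) <-> (exists r, c = y * l ^ r %[mod q ^ t])%N.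
Proof.
move=> q_pr coql genl; split=> [eq_gcd|[r cyl]]; last first.
  rewrite -gcdn_modl cyl gcdn_modl gcdnC Gauss_gcdl 1?gcdnC //.
  by rewrite coprimeXl // coprimeXr.
have /(dvdn_pfactor _ _ q_pr)[m le_mt def_m] := dvdn_gcdr y (q ^ t).
have [c' def_c] : exists c', c = (c' * q ^ m)%N.
  by apply/dvdnP; rewrite -def_m -eq_gcd dvdn_gcdl.
have [y' def_y] : exists y', y = (y' * q ^ m)%N.
  by apply/dvdnP; rewrite -def_m dvdn_gcdl.
(* If m = t, both c and y vanish modulo q^t. *)
have [lt_mt | ge_mt] := ltnP m t; last first.
  have -> : (t = m)%N by apply/anti_leq; rewrite ge_mt.
  by exists 0%N; rewrite def_c def_y expn0 muln1 !modnMl.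
have q_gt0 := prime_gt0 q_pr.
have co z z' : gcdn z (q ^ t) = (q ^ m)%N -> z = (z' * q ^ m)%N -> coprime q z'.
  move=> + def_z; rewrite def_z => gz; rewrite prime_coprime //.
  apply/negP => /dvdnP[w def_w].
  have : (q ^ m.+1 %| gcdn (z' * q ^ m) (q ^ t))%N.
    by rewrite dvdn_gcd dvdn_exp2l // def_w -mulnA -expnS dvdn_mull.
  by rewrite gz dvdn_Pexp2l ?prime_gt1 // ltnn.
have coc := co _ _ (etrans eq_gcd def_m) def_c.
have coy := co _ _ def_m def_y.
(* By Euler, the power of y' is an inverse of y' modulo q^t. *)
have [|r def_r] := genl (c' * y' ^ (totient (q ^ t)).-1)%N.
  by rewrite coprimeMr coc coprimeXr.
exists r; rewrite -modnMmr -def_r modnMmr def_c def_y.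
have -> : (y' * q ^ m * (c' * y' ^ (totient (q ^ t)).-1) =
  c' * q ^ m * y' ^ totient (q ^ t))%N.
  rewrite -[in RHS](@prednK (totient (q ^ t))) ?totient_gt0 ?expn_gt0 ?q_gt0 //.
  by rewrite expnS mulnACA [RHS]mulnACA (mulnC y').
by rewrite -[RHS]modnMmr Euler_exp_totient ?modnMmr ?muln1 // coprime_sym coprimeXl.
Qed.

Lemma gcdn_eq_pfactor (q t j z : nat) : prime q -> (j < t)%N ->
  (gcdn z (q ^ t) == q ^ j)%N = (q ^ j %| z)%N && ~~ (q ^ j.+1 %| z)%N.
Proof.
move=> q_pr lt_jt.
have /(dvdn_pfactor _ _ q_pr)[m le_mt def_m] := dvdn_gcdr z (q ^ t).
have dvd_z k : (k <= t)%N -> (q ^ k %| z)%N = (k <= m)%N.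
  move=> le_kt; rewrite -(dvdn_Pexp2l _ _ (prime_gt1 q_pr)) -def_m dvdn_gcd.
  by rewrite (dvdn_exp2l _ le_kt) andbT.
rewrite def_m eqn_exp2l ?prime_gt1 // !dvd_z ?(ltnW lt_jt) // -leqNgt.
by rewrite eq_sym eqn_leq.
Qed.

(** * Counting and cancelling residues *)

(** Each of the k consecutive blocks of d integers contains exactly one that is congruent to r0. *)
Lemma sum_neq_modn (k d r0 : nat) : (0 < d)%N ->
  (\sum_(r < k * d) (r0 != r %[mod d]) = k * d.-1)%N.
Proof.
move=> d_gt0; rewrite -(big_mkord xpredT (fun r => (r0 != r %[mod d])%N : nat)).
elim: k => [|k IHk]; first by rewrite !mul0n big_geq.
rewrite mulSnr (@big_cat_nat _ _ _ (k * d)) ?leq_addr //= IHk mulSnr.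
congr addn; rewrite -{1}(add0n (k * d)%N) big_addn addKn big_mkord.
rewrite (eq_bigr (fun r : 'I_d => (r != Ordinal (ltn_pmod r0 d_gt0)) : nat)).
  by rewrite -big_mkcond /= sum1_card cardC1 card_ord.
by move=> r _; rewrite [(r + _)%N]addnC modnMDl
    (modn_small (ltn_ord r)) eq_sym -val_eqE.
Qed.

Lemma inverse_modn (m x : nat) : (0 < m)%N -> coprime m x ->
  exists y, (x * y = 1 %[mod m])%N.
Proof.
move=> m_gt0 co_mx; exists (x ^ (totient m).-1)%N.
by rewrite -expnS prednK ?totient_gt0 // Euler_exp_totient // coprime_sym.
Qed.

Lemma modn_dvd (m d a b : nat) : (d %| m)%N ->
  (a = b %[mod m])%N -> (a = b %[mod d])%N.
Proof. by move=> dm ab; rewrite -(modn_dvdm a dm) ab modn_dvdm. Qed.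

Lemma eqn_mod_mulr (m c a b : nat) : (0 < m)%N -> coprime m c ->
  (a * c == b * c %[mod m])%N = (a == b %[mod m])%N.
Proof.
move=> m_gt0 /(inverse_modn m_gt0)[d cd].
apply/eqP/eqP => ab; last by rewrite -modnMml ab modnMml.
have := congr1 (fun z => z * d %% m)%N ab.
by rewrite !modnMml -!mulnA -![(_ * (c * d) %% m)%N]modnMmr cd !modnMmr !muln1.
Qed.

Lemma eqn_mod_pmul2l (m c a b : nat) : (0 < c)%N ->
  (c * a == c * b %[mod c * m])%N = (a == b %[mod m])%N.
Proof. by move=> c_gt0; rewrite -!muln_modr eqn_pmul2l. Qed.

Lemma eqn_mod_exp (m d l r r' : nat) : (0 < m)%N -> coprime m l ->
  (forall k, (l ^ k == 1 %[mod m])%N = (d %| k)%N) ->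
  (l ^ r == l ^ r' %[mod m])%N = (r == r' %[mod d])%N.
Proof.
move=> m_gt0 co_ml ord_l; wlog le_rr' : r r' / (r <= r')%N => [IH|].
  by case: (leqP r r') => [|/ltnW] /IH // ; rewrite eq_sym => ->; apply: eq_sym.
rewrite eq_sym [RHS]eq_sym [RHS]eqn_mod_dvd // -ord_l.
rewrite -{1}(subnK le_rr') expnD -{2}(mul1n (l ^ r)%N) eqn_mod_mulr //.
by rewrite coprimeXr.
Qed.

(* Dividing by p ^ i * q ^ j, adding b multiplies l ^ r by a number that is 1
   modulo p, hence a power of l by the lifting hypothesis. *)
Lemma p_part_translate (p q s l i j a b c : nat) :
  prime p -> coprime p q ->
  (forall u r, u = l ^ r %[mod p] -> exists r', u = l ^ r' %[mod p ^ s])%N ->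
  (p ^ i.+1 %| b)%N -> (a + b = c %[mod p ^ s])%N ->
  (exists r, a = p ^ i * q ^ j * l ^ r %[mod p ^ s])%N ->
  (exists r, c = p ^ i * q ^ j * l ^ r %[mod p ^ s])%N.
Proof.
move=> p_pr copq lift /dvdnP[w ->] abc [r def_a].
have ps_gt0 : (0 < p ^ s)%N by rewrite expn_gt0 prime_gt0.
have [y qy] : exists y, (q ^ j * y = 1 %[mod p ^ s])%N.
  by apply: inverse_modn; rewrite // coprimeXl // coprimeXr.
have [|r' def_u] := lift (l ^ r + p * (w * y))%N r.
  by rewrite mulnC addnC modnMDl.
exists r'; rewrite -modnMmr -def_u modnMmr -abc -modnDml def_a modnDml mulnDr.
rewrite -modnDmr -[in RHS]modnDmr; congr ((_ + _) %% _)%N.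
have -> : (p ^ i * q ^ j * (p * (w * y)) = w * p ^ i.+1 * (q ^ j * y))%N.
  by rewrite expnSr mulnACA (mulnC w (_ * _)%N) -[RHS]mulnA (mulnCA w).
by rewrite -[RHS]modnMmr qy modnMmr muln1.
Qed.

(** * Cyclotomic cosets and their sums in the quotient ring *)

Lemma mem_coset_nat (l n y : nat) (c : 'Z_n) : (1 < n)%N ->
  (c \in cyclotomic_coset l n y%:Z) <->
  (exists r, c = y * l ^ r %[mod n])%N.
Proof.
move=> n_gt1; split=> [/mem_cyclotomic_coset[r]|[r cr]].
  rewrite -PoszM -pmulrn => ->; exists r.
  by rewrite val_Zp_nat // modn_mod.
apply/mem_cyclotomic_coset; exists r; rewrite -PoszM -pmulrn; apply/val_inj.
by rewrite /= val_Zp_nat // -cr modn_small // -[X in (_ < X)%N](Zp_cast n_gt1).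
Qed.

Lemma qX_modn (l n a b : nat) : (0 < n)%N -> (a = b %[mod n])%N ->
  'qX ^+ a = 'qX ^+ b :> cyclic_ring l n.
Proof.
move=> n_gt0.
have qXn : ('qX : cyclic_ring l n) ^+ n = 1.
  rewrite /qpolyX -rmorphXn /= -(rmorph1 (in_qpoly ('X^n - 1 : {poly 'F_l}))).
  apply/eqP; rewrite -subr_eq0 -rmorphB /=; apply/eqP/val_inj => /=.
  by rewrite mk_monic_Xn_sub_1 // Pdiv.RingMonic.rmodpp // monicXnsubC.
have qXmod a' : ('qX : cyclic_ring l n) ^+ a' = 'qX ^+ (a' %% n).
  by rewrite {1}(divn_eq a' n) exprD mulnC exprM qXn expr1n mul1r.
by move=> ab; rewrite qXmod ab -qXmod.
Qed.

(** K is the exact period of y l^r modulo n, so the r < K enumerate the coset without repetition. *)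
Lemma coset_sum_powers (l n y K : nat) : (1 < n)%N -> (0 < K)%N ->
  (forall r r', (y * l ^ r == y * l ^ r' %[mod n]) = (r == r' %[mod K]))%N ->
  coset_sum l n y%:Z = \sum_(r < K) 'qX ^+ (y * l ^ r).
Proof.
move=> n_gt1 K_gt0 perK; pose f (r : 'I_K) : 'Z_n := (y * l ^ r)%:R.
have f_inj : injective f.
  move=> r r' /eqP; rewrite eqZp_modn // perK !modn_small // => /eqP.
  exact: val_inj.
rewrite /coset_sum (eq_bigl [in [set f r | r in 'I_K]]) => [|c]; last first.
  apply/idP/imsetP => [/mem_coset_nat[] // r cr | [r _ ->]]; last first.
    by apply/mem_coset_nat => //; exists r; rewrite val_Zp_nat // modn_mod.
  exists (Ordinal (ltn_pmod r K_gt0)) => //; apply/eqP.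
  rewrite -[c]natr_Zp eqZp_modn // cr perK /=; by rewrite modn_mod.
rewrite big_imset /=; last by move=> r r' _ _ /f_inj.
apply: eq_bigr => r _; apply: qX_modn; first exact: ltnW.
by rewrite val_Zp_nat // modn_mod.
Qed.

Lemma val_Zp_subK (n b : nat) (c : 'Z_n) : (1 < n)%N ->
  ((c - b%:R)%R + b = c %[mod n])%N.
Proof.
move=> n_gt1; set a := (c - _)%R.
have <- : (a + b)%:R = c by rewrite natrD natr_Zp subrK.
by rewrite val_Zp_nat // modn_mod.
Qed.

(** Multiplying by x^(f r) translates the coset by f r, so the coefficient of x^c counts the r for
    which c - f r lies in the coset. *)
Lemma coset_sum_mul_powers (l n y K : nat) (f : 'I_K -> nat) : (1 < n)%N ->
  coset_sum l n y%:Z * \sum_(r < K) 'qX ^+ f r =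
  \sum_(c : 'Z_n) 'qX ^+ c *+
    \sum_(r < K) ((c - (f r)%:R)%R \in cyclotomic_coset l n y%:Z).
Proof.
move=> n_gt1; rewrite /coset_sum mulr_sumr.
under [RHS]eq_bigr do rewrite -sumrMnr.
rewrite exchange_big; apply: eq_bigr => r _ /=.
rewrite mulr_suml (reindex_inj (addIr (- (f r)%:R))) /= big_mkcond /=.
apply: eq_bigr => c _; case: ifP => // _; rewrite mulr1n -exprD.
by apply: qX_modn; rewrite ?val_Zp_subK // ltnW.
Qed.

Lemma dvdn_eq_modn (m a b c : nat) : (a + b = c %[mod m])%N ->
  (m %| a)%N = (c == b %[mod m])%N.
Proof. by move=> abc; rewrite -abc -{2}(add0n b) eqn_modDr mod0n. Qed.

Lemma eq_modnM (m a b c d : nat) : (a = c %[mod m] -> b = d %[mod m] ->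
  a * b = c * d %[mod m])%N.
Proof. by move=> ac bd; rewrite -modnMm ac bd modnMm. Qed.

Lemma gcdn_mulpX (p q t i m w : nat) : prime p -> prime q -> p != q ->
  coprime q w -> (m <= t)%N -> gcdn (p ^ i * q ^ m * w) (q ^ t) = (q ^ m)%N.
Proof.
move=> p_pr q_pr neq_pq co_qw le_mt.
have copq : coprime q p by rewrite prime_coprime // dvdn_prime2 // eq_sym.
rewrite mulnAC gcdnC Gauss_gcdr; first by apply/gcdn_idPr; rewrite dvdn_exp2l.
by rewrite coprimeXl // coprimeMr co_qw coprimeXr.
Qed.

(** The Chinese remainder theorem splits membership into conditions modulo p^s and q^t; as l
    generates all units modulo q^t, the second sees only the gcd. *)
Lemma mem_coset_gcdn (s t p q l hP hQ y : nat) (c : 'Z_(p ^ s * q ^ t)) :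
  prime p -> prime q -> p != q -> (0 < s)%N -> coprime q l ->
  coprime hP hQ -> (l ^ hP = 1 %[mod p ^ s])%N -> (l ^ hQ = 1 %[mod q ^ t])%N ->
  (forall u, coprime q u -> exists r, u = l ^ r %[mod q ^ t])%N ->
  c \in cyclotomic_coset l (p ^ s * q ^ t) y%:Z <->
  (exists r, c = y * l ^ r %[mod p ^ s])%N /\ gcdn c (q ^ t) = gcdn y (q ^ t).
Proof.
move=> p_pr q_pr neq_pq s_gt0 coql coh lP lQ genq.
have n_gt1 : (1 < p ^ s * q ^ t)%N.
  rewrite (leq_trans (prime_gt1 p_pr)) // -{1}(expn1 p).
  by rewrite (leq_trans (leq_pexp2l _ s_gt0)) ?leq_pmulr ?expn_gt0 ?prime_gt0.
split=> [/(mem_coset_nat _ _ _ n_gt1)[r cr]|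
  [cP /(gcdn_eq_powers _ _ q_pr coql genq) cQ]].
  split; first by exists r; apply: modn_dvd cr; apply: dvdn_mulr.
  apply/(gcdn_eq_powers _ _ q_pr coql genq); exists r.
  by apply: modn_dvd cr; apply: dvdn_mull.
apply/(mem_coset_nat _ _ _ n_gt1); apply: modn_chinese_powers coh lP lQ cP cQ.
by rewrite coprimeXl // coprimeXr // prime_coprime // dvdn_prime2.
Qed.

(** * The product formula with general weights *)

(** The weights [w m] let one computation serve residues and nonresidues: they make p^i q^m w(m)
    satisfy the condition of C_ij modulo p^s while its gcd with q^t is q^m. The size of C_i'j is
    [N * q.-1]. *)
Lemma coset_sum_product (s t p q l a i i' j : nat) (w : nat -> nat) :
  prime p -> prime q -> p != q -> coprime p l -> coprime q l -> (0 < a)%N ->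
  (forall k r, (0 < k <= s) ->
     (l ^ r == 1 %[mod p ^ k]) = (p ^ k.-1 * a %| r))%N ->
  (forall k r, (0 < k <= t) ->
     (l ^ r == 1 %[mod q ^ k]) = (q ^ k.-1 * q.-1 %| r))%N ->
  (forall u r, u = l ^ r %[mod p] -> exists r', u = l ^ r' %[mod p ^ s])%N ->
  (forall u, coprime q u -> exists r, u = l ^ r %[mod q ^ t])%N ->
  coprime (p ^ s.-1 * a) (q ^ t.-1 * q.-1) ->
  (i < i' < s)%N -> (j < t)%N ->
  (forall m, j < m <= t ->
    coprime q (w m) /\ exists r, q ^ m * w m = q ^ j * l ^ r %[mod p ^ s])%N ->
  let N := (p ^ (s - i').-1 * a * q ^ (t - j).-1)%N in
  let n := (p ^ s * q ^ t)%N in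
  let X := coset_sum l n (p ^ i * q ^ j)%:Z in
  X * coset_sum l n (p ^ i' * q ^ j)%:Z
  = (N * (q - 2))%:R *: X
    + (N * q.-1)%:R *:
      (\sum_(j.+1 <= m < t.+1) coset_sum l n (p ^ i * q ^ m * w m)%:Z).
Proof.
move=> p_pr q_pr neq_pq copl coql a_gt0 ordp ordq liftp genq coh.
move=> /andP[lt_ii' lt_i's] lt_jt wP N n X.
have copq : coprime p q by rewrite prime_coprime // dvdn_prime2.
have [p_gt0 q_gt0] := (prime_gt0 p_pr, prime_gt0 q_pr).
have s_gt0 : (0 < s)%N by apply: leq_ltn_trans lt_i's.
have t_gt0 : (0 < t)%N by apply: leq_ltn_trans lt_jt.
have q1_gt0 : (0 < q.-1)%N by rewrite -subn1 subn_gt0 prime_gt1.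
have lP1 : (l ^ (p ^ s.-1 * a) = 1 %[mod p ^ s])%N.
  by apply/eqP; rewrite ordp ?s_gt0 /=.
have lQ1 : (l ^ (q ^ t.-1 * q.-1) = 1 %[mod q ^ t])%N.
  by apply/eqP; rewrite ordq ?t_gt0 /=.
have n_gt1 : (1 < n)%N.
  rewrite (leq_trans (prime_gt1 p_pr)) // -{1}(expn1 p).
  by rewrite (leq_trans (leq_pexp2l _ s_gt0)) ?leq_pmulr ?expn_gt0 ?q_gt0.
pose P c := (exists r, c = p ^ i * q ^ j * l ^ r %[mod p ^ s])%N.
pose C := cyclotomic_coset l n (p ^ i * q ^ j)%:Z.
pose D m := cyclotomic_coset l n (p ^ i * q ^ m * w m)%:Z.
have gcd_j k : gcdn (p ^ k * q ^ j) (q ^ t) = (q ^ j)%N.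
  by rewrite -[(p ^ k * _)%N]muln1 gcdn_mulpX ?coprimen1 // ltnW.
have memC (c : 'Z_n) : c \in C <-> P c /\ gcdn c (q ^ t) = (q ^ j)%N.
  by rewrite -(gcd_j i); apply: mem_coset_gcdn lP1 lQ1 genq.
have memD m (c : 'Z_n) : (j < m <= t)%N ->
    c \in D m <-> P c /\ gcdn c (q ^ t) = (q ^ m)%N.
  move=> m_jt; have [co_qw [r def_w]] := wP m m_jt; have /andP[_ le_mt] := m_jt.
  rewrite -(gcdn_mulpX i p_pr q_pr neq_pq co_qw le_mt).
  have DP := mem_coset_gcdn (p ^ i * q ^ m * w m) c p_pr q_pr neq_pq s_gt0 coql
    coh lP1 lQ1 genq.
  suff eqP_D : P c <-> (exists r, c = p ^ i * q ^ m * w m * l ^ r %[mod p ^ s])%N.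
    by split=> [/DP[/eqP_D ? ?]|[/eqP_D ? ?]] //; apply/DP.
  have defD z :
      (p ^ i * q ^ m * w m * z = p ^ i * q ^ j * l ^ r * z %[mod p ^ s])%N.
    apply: eq_modnM => //; rewrite -(mulnA _ _ (w m)) -(mulnA _ _ (l ^ r)%N).
    exact: eq_modnM.
  split=> -[r' cr]; last by exists (r + r')%N; rewrite cr defD expnD mulnA.
  (* With h = p^(s-1) a and l^h = 1 modulo p^s, the exponent r(h-1) stands for -r. *)
  exists (r * (p ^ s.-1 * a).-1 + r')%N.
  rewrite cr defD -(mulnA _ (l ^ r)%N) -expnD addnA.
  rewrite -mulnS prednK ?muln_gt0 ?expn_gt0 ?p_gt0 //.
  rewrite expnD; apply: eq_modnM => //.
  by rewrite -[RHS]modnMml (mulnC r) expnM -[in RHS]modnXm lP1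
    modnXm exp1n modnMml mul1n.
have kp : (0 < s - i')%N by rewrite subn_gt0.
have kq : (0 < t - j)%N by rewrite subn_gt0.
have ordP r : (l ^ r == 1 %[mod p ^ (s - i')])%N = (p ^ (s - i').-1 * a %| r)%N.
  by apply: ordp; rewrite kp leq_subr.
have ordQ r : (l ^ r == 1 %[mod q ^ (t - j)])%N = (q ^ (t - j).-1 * q.-1 %| r)%N.
  by apply: ordq; rewrite kq leq_subr.
have coK : coprime (p ^ (s - i').-1 * a) (q ^ (t - j).-1 * q.-1).
  apply: coprime_dvdl (coprime_dvdr _ coh); apply: dvdn_mul => //;
  by apply: dvdn_exp2l; rewrite -!subn1 leq_sub2r ?leq_subr.
have defK : (N * q.-1 = p ^ (s - i').-1 * a * (q ^ (t - j).-1 * q.-1))%N.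
  by rewrite /N mulnA.
have K_gt0 : (0 < N * q.-1)%N by rewrite /N !muln_gt0 !expn_gt0 p_gt0 q_gt0 a_gt0.
(* Dividing by p^i' q^j leaves the modulus p^(s-i') q^(t-j), where the order of l is the product of
   two coprime orders. *)
have period r r' :
    (p ^ i' * q ^ j * l ^ r == p ^ i' * q ^ j * l ^ r' %[mod n])%N
    = (r == r' %[mod N * q.-1])%N.
  have -> : n = (p ^ i' * q ^ j * (p ^ (s - i') * q ^ (t - j)))%N.
    by rewrite mulnACA -!expnD !subnKC // ltnW.
  rewrite eqn_mod_pmul2l ?muln_gt0 ?expn_gt0 ?p_gt0 ?q_gt0 //.
  rewrite chinese_remainder ?coprimeXl ?coprimeXr // defK chinese_remainder //.
  by congr andb; apply: eqn_mod_exp; rewrite ?expn_gt0 ?p_gt0 ?q_gt0 // coprimeXl.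
rewrite [in LHS](coset_sum_powers n_gt1 K_gt0 period) coset_sum_mul_powers //.
pose Dsum (c : 'Z_n) := (\sum_(j.+1 <= m < t.+1) (c \in D m))%N.
(* It suffices to compare the coefficients of each x^c. *)
suff count (c : 'Z_n) :
  (\sum_(r < N * q.-1) ((c - (p ^ i' * q ^ j * l ^ r)%:R)%R \in C)
   = (c \in C) * (N * (q - 2)) + Dsum c * (N * q.-1))%N.
  under eq_bigr => c _.
    rewrite count mulrnDr (mulrnA _ (c \in C)) (mulrnA _ (Dsum c)); over.
  rewrite big_split /= !scaler_nat !sumrMnl; congr (_ *+ _ + _ *+ _).
    rewrite /X /coset_sum [RHS]big_mkcond /=; apply: eq_bigr => c _.
    by rewrite -/C; case: (c \in C).
  rewrite /coset_sum; under [RHS]eq_bigr do rewrite big_mkcond.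
  rewrite exchange_big /=; apply: eq_bigr => c _.
  rewrite /Dsum -sumrMnr; apply: eq_bigr => m _.
  by rewrite -/(D m); case: (c \in D m).
have aP r : let b := (p ^ i' * q ^ j * l ^ r)%N in
  P c <-> P (c - b%:R).
  move=> b; have dvd_b : (p ^ i.+1 %| b)%N.
    by rewrite /b -mulnA dvdn_mulr // dvdn_exp2l.
  have ab : ((c - b%:R)%R + b = c %[mod p ^ s])%N.
    by apply: modn_dvd (val_Zp_subK _ _ n_gt1); apply: dvdn_mulr.
  split; last exact: p_part_translate ab.
  (* Here b (p^s - 1) plays the role of -b modulo p^s. *)
  apply: (p_part_translate (b := (b * (p ^ s).-1)%N)) => //; first by rewrite dvdn_mulr.
  rewrite -modnDml -ab modnDml -addnA -mulnS prednK ?expn_gt0 ?p_gt0 //.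
  by rewrite addnC modnMDl.
pose b r := (p ^ i' * q ^ j * l ^ r)%N.
have dvd_b r : (q ^ j %| b r)%N by rewrite /b mulnAC dvdn_mull.
have dvd_a k r : (k <= t)%N ->
    (q ^ k %| (c - (b r)%:R)%R)%N = (c == b r %[mod q ^ k])%N.
  move=> le_kt; apply: dvdn_eq_modn; apply: modn_dvd (val_Zp_subK _ _ n_gt1).
  by rewrite dvdn_mull // dvdn_exp2l.
(* Translation preserves P, and q^j divides the difference, so membership fails only if q^(j+1)
   divides it too. *)
have sub_memC r : P c -> (q ^ j %| c)%N ->
    ((c - (b r)%:R)%R \in C) = (c != b r %[mod q ^ j.+1])%N.
  move=> /aP-/(_ r) Pa qj_c; rewrite -dvd_a //.
  have -> : (~~ (q ^ j.+1 %| (c - (b r)%:R)%R) =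
      (gcdn (c - (b r)%:R)%R (q ^ t) == q ^ j))%N.
    rewrite gcdn_eq_pfactor // (dvd_a j) ?(ltnW lt_jt) //.
    by move: qj_c (dvd_b r); rewrite /dvdn => /eqP-> /eqP->; rewrite eqxx.
  by apply/idP/eqP => [/memC[]|] // ?; apply/memC.
have [cC | cC] := boolP (c \in C).
  have [Pc gcd_c] := (memC c).1 cC.
  have qj_c : (q ^ j %| c)%N by rewrite -gcd_c dvdn_gcdl.
  have -> : Dsum c = 0%N.
    rewrite /Dsum big_nat big1 // => m m_jt; apply/eqP; rewrite eqb0.
    apply/negP => /(memD _ _ m_jt)[_]; rewrite gcd_c => /eqP.
    by rewrite eqn_exp2l ?prime_gt1 // => /eqP jm; rewrite -jm ltnn in m_jt.
  have [r1 cr1] : exists r1, (c = b r1 %[mod q ^ t])%N.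
    by apply/(gcdn_eq_powers _ _ q_pr coql genq); rewrite gcd_j.
  have {}cr1 : (c = b r1 %[mod q ^ j.+1])%N by apply: modn_dvd cr1; apply: dvdn_exp2l.
  under eq_bigr => r _ do rewrite sub_memC // cr1.
  (* After cancelling q^j and the unit p^i', the condition says that l^r1 and l^r differ modulo q,
     hence that r1 and r differ modulo q - 1, the order of l modulo q. *)
  rewrite mul1n mul0n addn0 subn2 -(sum_neq_modn N r1 q1_gt0).
  apply: eq_bigr => r _; congr (nat_of_bool (~~ _)).
  rewrite /b ![(p ^ i' * _)%N]mulnC -!mulnA expnSr eqn_mod_pmul2l ?expn_gt0 ?q_gt0 //.
  rewrite ![(p ^ i' * _)%N]mulnC eqn_mod_mulr ?coprimeXr 1?coprime_sym //.
  apply: eqn_mod_exp => // k.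
  by have := ordq 1%N k t_gt0; rewrite expn1 mul1n.
rewrite mul0n add0n.
have [/hasP[m m_jt cD] | noD] :=
  boolP (has (fun m => c \in D m) (index_iota j.+1 t.+1)).
  have m_jt' : (j < m <= t)%N by rewrite mem_index_iota ltnS in m_jt.
  have [Pc gcd_c] := (memD m c m_jt').1 cD; have /andP[lt_jm _] := m_jt'.
  have qj1_c : (q ^ j.+1 %| c)%N.
    by apply: dvdn_trans (dvdn_gcdl c (q ^ t)); rewrite gcd_c dvdn_exp2l.
  have qj_c : (q ^ j %| c)%N by apply: dvdn_trans qj1_c; apply: dvdn_exp2l.
  have -> : Dsum c = 1%N.
    rewrite /Dsum (bigD1_seq m) ?iota_uniq //= cD big_nat_cond big1 // => m'.
    rewrite ltnS => /andP[m'_jt neq_m'm]; apply/eqP; rewrite eqb0.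
    apply: contra neq_m'm => /(memD _ _ m'_jt)[_]; rewrite gcd_c => /eqP.
    by rewrite eqn_exp2l ?prime_gt1 // eq_sym.
  (* Here q^(j+1) divides c but no [b r], so every r counts. *)
  rewrite mul1n -[RHS]muln1 -[in RHS](card_ord (N * q.-1)) -sum_nat_const.
  apply: eq_bigr => r _; rewrite sub_memC // eq_sym -(dvdn_eq_modn (a := b r)).
    rewrite /b expnSr -mulnA mulnCA dvdn_pmul2l ?expn_gt0 ?q_gt0 //.
    by rewrite -prime_coprime // coprimeMr !coprimeXr // coprime_sym.
  by move/eqP: qj1_c => qj1_c; rewrite -modnDmr qj1_c addn0.
have -> : Dsum c = 0%N.
  rewrite /Dsum big_seq big1 // => m m_jt; apply/eqP; rewrite eqb0.
  by apply: contra noD => cD; apply/hasP; exists m.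
(* If some c - [b r] were in C, then P would hold for c and its gcd with q^t would be q^m with m >=
   j, putting c in C or in some [D m]. *)
rewrite big1 // => r _; apply/eqP; rewrite eqb0; apply/negP => /memC[Pa gcd_a].
have Pc : P c by apply/(aP r).
have qj_c : (q ^ j %| c)%N.
  have : (q ^ j %| (c - (b r)%:R)%R)%N by rewrite -gcd_a dvdn_gcdl.
  by rewrite dvd_a ?(ltnW lt_jt) // => /eqP; rewrite /dvdn => ->; apply: dvd_b.
have /(dvdn_pfactor _ _ q_pr)[m le_mt gcd_c] := dvdn_gcdr c (q ^ t).
have : (q ^ j %| gcdn c (q ^ t))%N by rewrite dvdn_gcd qj_c dvdn_exp2l // ltnW.
rewrite gcd_c dvdn_Pexp2l ?prime_gt1 // leq_eqVlt => /orP[/eqP jm | lt_jm].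
  by move/negP: cC; apply; apply/memC; rewrite gcd_c jm.
move/negP: noD; apply; apply/hasP; exists m; first by rewrite mem_index_iota lt_jm.
by apply/memD; rewrite ?lt_jm.
Qed.

(** * Natural representatives, and squares modulo powers of p *)

(** This replaces the integer g, of either sign, by one natural number valid for p^s, q^t and n at
    once. *)
Lemma int_modn_nat (n : nat) (g : int) : (0 < n)%N -> exists g' : nat,
  forall m, (1 < m)%N -> (m %| n)%N -> g%:~R = g'%:Z%:~R :> 'Z_m.
Proof.
move=> n_gt0; exists `|(g %% n)%Z|%N => m m_gt1 dvd_mn.
rewrite {1}(divz_eq g n) intrD intrM -[n%:~R]pmulrn.
have -> : n%:R = 0 :> 'Z_m.
  by apply/eqP; rewrite (eqZp_modn n 0 m_gt1) mod0n; apply: dvd_mn.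
rewrite mulr0 add0r gez0_abs // modz_ge0 //.
by rewrite eqz_nat -lt0n.
Qed.

Lemma totient_half (p k : nat) : prime p -> odd p -> (0 < k)%N ->
  (totient (p ^ k) %/ 2 = p ^ k.-1 * p./2)%N.
Proof.
move=> p_pr p_odd k_gt0; rewrite totient_pfactor // divn2 mulnC.
by rewrite -(odd_halfK p_odd) -doubleMr doubleK.
Qed.

Lemma mulord_intr (m : nat) (g g' : int) :
  g%:~R = g'%:~R :> 'Z_m -> mulord m g = mulord m g'.
Proof. by rewrite /mulord => ->. Qed.

Lemma coset_sum_intr (l n : nat) (g g' : int) :
  g%:~R = g'%:~R :> 'Z_n -> coset_sum l n g = coset_sum l n g'.
Proof. by rewrite /coset_sum /cyclotomic_coset => ->. Qed.

Lemma exp_totient_coprimeXl (p k u : nat) : (0 < k)%N -> coprime p u ->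
  (u ^ totient (p ^ k) = 1 %[mod p ^ k])%N.
Proof.
by move=> k_gt0 co_pu; apply: Euler_exp_totient; rewrite coprime_sym coprimeXl.
Qed.

(* As p ^ s.-1 * p./2 is odd, l is a square modulo p ^ s, hence modulo every
   p ^ k; this gives the direction of divisibility that does not follow from
   lifting exponents. *)
Lemma half_order_reduction (p s l k r : nat) : prime p -> odd p -> odd p./2 ->
  coprime p l -> (0 < k <= s)%N ->
  (forall r, (l ^ r == 1 %[mod p ^ s]) = (p ^ s.-1 * p./2 %| r))%N ->
  ((l ^ r == 1 %[mod p ^ k]) = (p ^ k.-1 * p./2 %| r))%N.
Proof.
move=> p_pr p_odd odd_a copl /andP[k_gt0 le_ks] ordl.
apply/eqP/idP => [|/dvdnP[e ->]].
  by apply: dvdn_order_reduction ordl; rewrite ?k_gt0.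
set h := (p ^ s.-1 * p./2)%N in ordl.
have odd_h : odd h by rewrite oddM oddX p_odd orbT.
have lh : (l ^ h = 1 %[mod p ^ k])%N.
  by apply: (@modn_dvd (p ^ s)); [exact: dvdn_exp2l | apply/eqP; rewrite ordl].
have l_sq : (l = (l ^ h.+1./2) ^ 2 %[mod p ^ k])%N.
  rewrite -expnM muln2 -[in RHS](uphalfE h) odd_uphalfK // expnS.
  by rewrite -modnMmr lh modnMmr muln1.
suff lk : (l ^ (p ^ k.-1 * p./2) = 1 %[mod p ^ k])%N.
  by rewrite mulnC expnM -modnXm lk modnXm exp1n.
rewrite -modnXm l_sq modnXm -expnM.
have -> : (2 * (p ^ k.-1 * p./2) = totient (p ^ k))%N.
  by rewrite totient_pfactor // -(odd_halfK p_odd) mul2n doubleMr mulnC.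
by rewrite exp_totient_coprimeXl ?coprimeXr.
Qed.

(** Being a power of l modulo p, u satisfies u^((p-1)/2) = 1 modulo p; raising to p^(s-1) gives u^h
    = 1 modulo p^s with h the order of l there, which puts u among the powers of l. *)
Lemma half_order_lift (p s l u r : nat) (g : int) : prime p ->
  coprime p l -> (0 < s)%N -> primitive_root_mod (p ^ s) g ->
  mulord (p ^ s) l%:Z = (p ^ s.-1 * p./2)%N ->
  (forall r, (l ^ r == 1 %[mod p]) = (p./2 %| r))%N ->
  (u = l ^ r %[mod p])%N -> exists r', (u = l ^ r' %[mod p ^ s])%N.
Proof.
move=> p_pr copl s_gt0 g_prim ord_l ordp1 ulr.
have co_pu : coprime p u.
  by rewrite -coprime_modr ulr coprime_modr coprimeXr.
have ps_gt1 : (1 < p ^ s)%N by rewrite -(exp1n s) ltn_exp2r ?prime_gt1.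
apply: (mem_powers_of_exp_mulord ps_gt1 g_prim); rewrite ?coprimeXl // ord_l.
have ua : (u ^ p./2 = 1 %[mod p ^ 1])%N.
  rewrite expn1 -modnXm ulr modnXm -expnM; apply/eqP.
  by rewrite ordp1 dvdn_mull.
have := pow_pX_eq1_modn s.-1 p_pr (ltn0Sn 0) ua.
by rewrite -expnM add1n prednK // mulnC.
Qed.

(** Write q = g^e. An even e would make g^(e/2) a square root of q modulo p, so e is odd and q g =
    g^(e+1) is a square; the exponent is half the totient. *)
Lemma nonresidue_mul_primitive_root (p s q g : nat) :
  prime p -> odd p -> (0 < s)%N -> coprime p q -> coprime p g ->
  primitive_root_mod (p ^ s) g%:Z -> quadratic_nonresidue p q ->
  ((q * g) ^ (p ^ s.-1 * p./2) = 1 %[mod p ^ s])%N.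
Proof.
move=> p_pr p_odd s_gt0 co_pq co_pg g_prim /andP[_ /existsPn q_nsq].
have ps_gt1 : (1 < p ^ s)%N by rewrite -(exp1n s) ltn_exp2r ?prime_gt1.
have [e qe] : exists e, (q = g ^ e %[mod p ^ s])%N.
  apply: (mem_powers_of_exp_mulord ps_gt1 g_prim); rewrite ?coprimeXl //.
  by rewrite (eqP g_prim) exp_totient_coprimeXl.
have odd_e : odd e.
  apply: contraT => even_e; have p_gt0 := prime_gt0 p_pr.
  have /negP[] := q_nsq (Ordinal (ltn_pmod (g ^ e./2) p_gt0)).
  rewrite /= modnXm -expnM muln2 even_halfK // eq_sym; apply/eqP.
  by apply: modn_dvd qe; rewrite -{1}(expn1 p) dvdn_exp2l.
rewrite -modnXm -modnMml qe modnMml modnXm -expnSr -expnM.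
have -> : (e.+1 * (p ^ s.-1 * p./2) = totient (p ^ s) * uphalf e)%N.
  rewrite totient_pfactor // -(odd_halfK p_odd) -{1}(odd_uphalfK odd_e).
  rewrite -!muln2 [RHS]mulnC -[LHS]mulnA; congr muln.
  by rewrite mulnC -mulnA mulnC.
by rewrite expnM -modnXm exp_totient_coprimeXl // modnXm exp1n.
Qed.

(** The easy half of Euler's criterion modulo p, lifted to p^s by a p^(s-1)-th power. *)
Lemma residue_half_power (p s q : nat) :
  prime p -> odd p -> (0 < s)%N -> quadratic_residue p q ->
  (q ^ (p ^ s.-1 * p./2) = 1 %[mod p ^ s])%N.
Proof.
move=> p_pr p_odd s_gt0 /andP[co_pq /existsP[x /eqP xq]].
have co_px : coprime p x.
  by rewrite -(@coprime_pexpr 2) // -coprime_modr xq coprime_modr.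
have qa : (q ^ p./2 = 1 %[mod p ^ 1])%N.
  rewrite expn1 -modnXm -xq modnXm -expnM mul2n odd_halfK //.
  by have := exp_totient_coprimeXl (ltn0Sn 0) co_px; rewrite expn1 totient_prime.
have := pow_pX_eq1_modn s.-1 p_pr (ltn0Sn 0) qa.
by rewrite -expnM add1n prednK // mulnC.
Qed.

(** * Verification of the order conditions and choice of weights *)

Theorem theorem4p13 (s t p q l : nat) (g : int) :
  (1 <= s)%N -> (1 <= t)%N ->
  prime p -> prime q -> prime l ->
  p != q -> p != l -> q != l ->
  odd p -> odd q ->
  p = 3 %[mod 4] ->
  mulord (p ^ s) l%:Z = (totient (p ^ s) %/ 2)%N ->
  mulord (q ^ t) l%:Z = totient (q ^ t) ->
  gcdn (totient (p ^ s)) (totient (q ^ t)) = 2%N ->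
  primitive_root_mod (p ^ s) g -> primitive_root_mod (q ^ t) g ->
  forall i i' j : nat,
  (i < i')%N -> (i' <= s - 1)%N -> (j <= t - 1)%N ->
  let X := chi p q s t l in
  let Xs := chi_star p q s t l g in
  let A := (totient (p ^ (s - i')) %/ 2 * ((q - 2) * q ^ (t - j - 1)))%N in
  let B := (totient (p ^ (s - i')) %/ 2 * totient (q ^ (t - j)))%N in
  (quadratic_residue p q ->
     X i j * X i' j
     = A%:R *: X i j + B%:R *: (\sum_(j.+1 <= m < t.+1) X i m))
  /\
  (quadratic_nonresidue p q ->
     X i j * X i' j
     = A%:R *: X i j
       + B%:R *: (\sum_(j.+1 <= m < t.+1 | odd (m - j)) Xs i m
                  + \sum_(j.+1 <= m < t.+1 | ~~ odd (m - j)) X i m)).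
Proof.
move=> s_gt0 t_gt0 p_pr q_pr l_pr neq_pq neq_pl neq_ql p_odd q_odd p_mod4.
move=> ord_p ord_q gcd_tot g_primp g_primq i i' j lt_ii' le_i's le_jt X Xs A B.
have [p_gt0 q_gt0] := (prime_gt0 p_pr, prime_gt0 q_pr).
have lt_i's : (i' < s)%N by rewrite -(prednK s_gt0) ltnS -subn1.
have lt_jt : (j < t)%N by rewrite -(prednK t_gt0) ltnS -subn1.
have copq : coprime p q by rewrite prime_coprime // dvdn_prime2.
have copl : coprime p l by rewrite prime_coprime // dvdn_prime2.
have coql : coprime q l by rewrite prime_coprime // dvdn_prime2.
have ps_gt1 : (1 < p ^ s)%N by rewrite -(exp1n s) ltn_exp2r ?prime_gt1.
have qt_gt1 : (1 < q ^ t)%N by rewrite -(exp1n t) ltn_exp2r ?prime_gt1.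
have pq_gt1 : (1 < p ^ s * q ^ t)%N by rewrite (leq_trans ps_gt1) ?leq_pmulr // ltnW.
(* From p = 4k + 3 one gets [p./2] = 2k + 1. *)
have a_odd : odd p./2.
  rewrite (divn_eq p 4) p_mod4 -[4%N]/(2 * 2)%N.
  rewrite mulnA !muln2 halfD odd_double doubleK.
  by rewrite !oddD odd_double.
have a_gt0 : (0 < p./2)%N by case: p./2 a_odd.
rewrite totient_half // in ord_p.
(* The order of l modulo p^s divides the totient, so the gcd divides 2; that order is odd, so the
   gcd is 1. *)
have coh : coprime (p ^ s.-1 * p./2) (q ^ t.-1 * q.-1).
  set h := (p ^ s.-1 * _)%N; have h_odd : odd h by rewrite oddM oddX p_odd orbT.
  rewrite mulnC -totient_pfactor // /coprime; set d := gcdn _ _.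
  have : (d %| 2)%N.
    rewrite -gcd_tot dvdn_gcd dvdn_gcdr andbT.
    rewrite (dvdn_trans (dvdn_gcdl _ _)) // totient_pfactor //.
    by rewrite -(odd_halfK p_odd) mulnC -doubleMr -muln2 dvdn_mulr.
  have /primeP[_ /[apply] /orP[] // /eqP d2] : prime 2 by [].
  by have := dvdn_odd (dvdn_gcdl h (totient (q ^ t))) h_odd; rewrite -/d d2.
have [_ ordps] : coprime (p ^ s) l /\
    forall r, (l ^ r == 1 %[mod p ^ s])%N = (p ^ s.-1 * p./2 %| r)%N.
  by rewrite -ord_p; apply: mulordP; rewrite // ord_p muln_gt0 expn_gt0 p_gt0.
have [_ ordqt] : coprime (q ^ t) l /\
    forall r, (l ^ r == 1 %[mod q ^ t])%N = (q ^ t.-1 * q.-1 %| r)%N.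
  rewrite mulnC -totient_pfactor // -ord_q; apply: mulordP; rewrite // ord_q.
  by rewrite totient_gt0 expn_gt0 q_gt0.
have ordp k r : (0 < k <= s)%N ->
    (l ^ r == 1 %[mod p ^ k])%N = (p ^ k.-1 * p./2 %| r)%N.
  by move=> k_s; apply: half_order_reduction ordps.
have ordq k r : (0 < k <= t)%N ->
    (l ^ r == 1 %[mod q ^ k])%N = (q ^ k.-1 * q.-1 %| r)%N.
  move=> k_t; have /andP[k_gt0 _] := k_t; apply/eqP/idP => [|/dvdnP[e ->]].
    exact: dvdn_order_reduction ordqt.
  rewrite (mulnC (q ^ _)%N) -totient_pfactor // mulnC expnM -modnXm.
  by rewrite exp_totient_coprimeXl // modnXm exp1n.
have ordp1 r : (l ^ r == 1 %[mod p])%N = (p./2 %| r)%N.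
  by have := ordp 1%N r s_gt0; rewrite expn1 mul1n.
have liftp u r :=
  half_order_lift (u := u) (r := r) p_pr copl s_gt0 g_primp ord_p ordp1.
have genq u : coprime q u -> exists r, (u = l ^ r %[mod q ^ t])%N.
  move=> co_qu; apply: (mem_powers_of_exp_mulord qt_gt1 g_primq); rewrite ?coprimeXl //.
  by rewrite ord_q exp_totient_coprimeXl.
have genp u : coprime p u -> (u ^ (p ^ s.-1 * p./2) = 1 %[mod p ^ s])%N ->
    exists r, (u = l ^ r %[mod p ^ s])%N.
  move=> co_pu; rewrite -ord_p.
  by apply: (mem_powers_of_exp_mulord ps_gt1 g_primp); rewrite ?coprimeXl.
have defA : A = (p ^ (s - i').-1 * p./2 * q ^ (t - j).-1 * (q - 2))%N.
  by rewrite /A totient_half ?subn_gt0 // subn1 (mulnC (q - 2)%N) mulnA.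
have defB : B = (p ^ (s - i').-1 * p./2 * q ^ (t - j).-1 * q.-1)%N.
  by rewrite /B totient_half ?totient_pfactor ?subn_gt0 // (mulnC q.-1) mulnA.
have product w wP := @coset_sum_product s t p q l p./2 i i' j w p_pr q_pr neq_pq
  copl coql a_gt0 ordp ordq liftp genq coh
  (introT andP (conj lt_ii' lt_i's)) lt_jt wP.
rewrite /= -defA -defB in product.
(* With q^j factored out, it suffices that q^(m-j) times the weight be a power of l modulo p^s. *)
have shift m w r : (j < m)%N -> (q ^ (m - j) * w = l ^ r %[mod p ^ s])%N ->
    (q ^ m * w = q ^ j * l ^ r %[mod p ^ s])%N.
  by move=> lt_jm qwr; rewrite -(subnKC (ltnW lt_jm)) expnD -mulnA; apply: eq_modnM.
split=> [q_res | q_nonres].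
  rewrite /X /chi (product (fun=> 1%N)) => [|m /andP[lt_jm _]].
    by under eq_bigr do rewrite muln1.
  split; first exact: coprimen1.
  have [|r qr] := genp q copq; first exact: residue_half_power.
  exists (r * (m - j))%N; apply: shift => //.
  by rewrite muln1 -modnXm qr modnXm expnM.
have [g' def_g] := int_modn_nat g (ltnW pq_gt1).
have prim_g' m : (1 < m)%N -> (m %| p ^ s * q ^ t)%N ->
    primitive_root_mod m g -> coprime m g' /\ primitive_root_mod m g'%:Z.
  move=> m_gt1 m_dvd; rewrite /primitive_root_mod (mulord_intr (def_g m m_gt1 m_dvd)).
  move=> g_prim; split=> //; apply: (mulordP m_gt1 _).1.
  by rewrite (eqP g_prim) totient_gt0 ltnW.
have [copsg g'_primp] := prim_g' _ ps_gt1 (dvdn_mulr _ (dvdnn _)) g_primp.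
have [coqtg _] := prim_g' _ qt_gt1 (dvdn_mull _ (dvdnn _)) g_primq.
rewrite coprime_pexpl // in copsg; rewrite coprime_pexpl // in coqtg.
(* For odd m - j, q^(m-j) is a nonresidue and the factor g' turns it into a square; for even m - j
   it is already one. *)
rewrite /X /chi (product (fun m => if odd (m - j) then g' else 1%N)).
  congr (_ + _ *: _); rewrite [X in _ = X + _]big_mkcond [X in _ = _ + X]big_mkcond.
  rewrite -big_split /=; apply: eq_bigr => m _; case: ifP => _ /=.
    rewrite addr0 /Xs /chi_star; apply: coset_sum_intr.
    by rewrite PoszM !intrM (def_g _ pq_gt1 (dvdnn _)).
  by rewrite add0r muln1.
move=> m /andP[lt_jm _]; split; first by case: ifP; rewrite ?coprimen1.
have [r qr] : exists r,
    (q ^ (m - j) * (if odd (m - j) then g' else 1) = l ^ r %[mod p ^ s])%N.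
  set h := (p ^ s.-1 * p./2)%N in genp.
  have q2 e : (q ^ (e.*2 * h) = 1 %[mod p ^ s])%N.
    rewrite -mul2n -mulnA mulnCA.
    have -> : (2 * h = totient (p ^ s))%N.
      by rewrite totient_pfactor // -(odd_halfK p_odd) mul2n /h doubleMr mulnC.
    by rewrite mulnC expnM -modnXm exp_totient_coprimeXl // modnXm exp1n.
  apply: genp; first by case: ifP => _; rewrite coprimeMr ?coprimen1 ?copsg coprimeXr.
  (* The even part of m - j contributes 1, as twice h is the totient of p^s; for odd m - j only q g'
     remains. *)
  rewrite -{1}(odd_double_half (m - j)); case: ifP => _ /=.
    rewrite add1n expnSr -mulnA expnMn -expnM -modnMml q2 modnMml mul1n.
    exact: nonresidue_mul_primitive_root.
  by rewrite add0n muln1 -expnM.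
by exists r; apply: shift.
Qed.
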